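(* Let $n\in\mathbb{N}$ and $\varphi\in\mathcal{D}_n$. Then $\varphi\in\mathcal{P}_n$ if and only if $$\varphi\,P_1\cdots P_k=0$$ for all compositions $q=q_1.\cdots.q_k$ of $n$ such that $q_1$ is even and all $P_1\in L_{q_1}(X),\ldots,P_k\in L_{q_k}(X)$.
   Context: $K$ is a field of characteristic $0$. Permutations act on the right ($i\pi$ is the image of $i$) and products in $S_n$ are read from left to right. For $\pi\in S_n$: $\mathrm{Des}(\pi)=\{1\le i\le n-1\mid i\pi>(i+1)\pi\}$, $\mathrm{Peak}(\pi)=\{2\le i\le n-1\mid (i-1)\pi<i\pi>(i+1)\pi\}$. $\mathcal{D}_n$ is the $K$-linear span in $KS_n$ of the elements $\sum_{\mathrm{Des}(\pi)=D}\pi$, $D\subseteq\{1,\ldots,n-1\}$; $\mathcal{P}_n$ is the $K$-linear span of the elements $\sum_{\mathrm{Peak}(\pi)=P}\pi$, $P\subseteq\{2,\ldots,n-1\}$. A composition of $n$ is a finite word $q_1.\cdots.q_k$ of positive integers with sum $n$. $X$ is an infinite alphabet, $A(X)$ the free associative $K$-algebra over $X$, $A_n(X)$ its $n$-th homogeneous component. $KS_n$ acts on $A_n(X)$ from the left via Polya action, the linear extension of $\pi(x_1\cdots x_n):=x_{1\pi}\cdots x_{n\pi}$ ($\pi\in S_n$, $x_1,\ldots,x_n\in X$). $L(X)$ is the Lie subalgebra of $A(X)$ (with Lie product $ab-ba$) generated by $X$, and $L_m(X)=L(X)\cap A_m(X)$. *)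

(* Defs.v *)
From mathcomp Require Import all_boot all_order all_algebra all_fingroup.
From mathcomp Require Import finmap monalg.

Set Implicit Arguments.
Unset Strict Implicit.
Unset Printing Implicit Defensive.

Import GRing.Theory.
Local Open Scope ring_scope.

(* The underlying vector space of K S_n: functions 'S_n -> K, a permutation
   being identified with its indicator function. *)
Notation permspace K n := {ffun 'S_n -> K^o}.

(* The position p in {1, ..., n} is represented by the ordinal i = p - 1, so
   that {1, ..., n-1} is [set i : 'I_n | i.+1 < n] and {2, ..., n-1} is
   [set i : 'I_n | 0 < i & i.+1 < n]. *)
Definition Des (n : nat) (s : 'S_n) : {set 'I_n} :=
  [set i : 'I_n | [exists j : 'I_n, (j == i.+1 :> nat) && (s j < s i)%N]].

Definition Peak (n : nat) (s : 'S_n) : {set 'I_n} :=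
  [set i : 'I_n | [exists h : 'I_n, exists j : 'I_n,
    [&& i == h.+1 :> nat, j == i.+1 :> nat, (s h < s i)%N & (s j < s i)%N]]].

Definition des_sum (K : fieldType) (n : nat) (D : {set 'I_n}) : permspace K n :=
  [ffun s => (Des s == D)%:R].

Definition peak_sum (K : fieldType) (n : nat) (P : {set 'I_n}) :
    permspace K n :=
  [ffun s => (Peak s == P)%:R].

Definition descent_space (K : fieldType) (n : nat) : {vspace permspace K n} :=
  <<[seq des_sum K D | D : {set 'I_n}
       in powerset [set i : 'I_n | (i.+1 < n)%N]]>>%VS.

Definition peak_space (K : fieldType) (n : nat) : {vspace permspace K n} :=
  <<[seq peak_sum K P | P : {set 'I_n}
       in powerset [set i : 'I_n | (0 < i)%N && (i.+1 < n)%N]]>>%VS.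

Definition composition (n : nat) (q : seq nat) : bool :=
  all (fun m => 0 < m)%N q && (sumn q == n).

(* The free associative algebra: the algebra of the free monoid on X. *)
Notation freeAlg K X := {malg K[{fmonom X}]}.

Definition homogeneous (K : fieldType) (X : choiceType) (m : nat)
    (f : freeAlg K X) : Prop :=
  forall w : {fmonom X}, w \in msupp f -> fdeg w = m.

Inductive lie (K : fieldType) (X : choiceType) : freeAlg K X -> Prop :=
| lie_gen (x : X) : lie << fmu x >>
| lie_zero : lie 0
| lie_linear (a : K) (f g : freeAlg K X) : lie f -> lie g -> lie (a *: f + g)
| lie_bracket (f g : freeAlg K X) : lie f -> lie g -> lie (f * g - g * f).

Definition lie_homog (K : fieldType) (X : choiceType) (m : nat)
    (f : freeAlg K X) : Prop :=
  lie f /\ homogeneous m f.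

(* Place permutation of a word of length n; words of any other length are left
   unchanged, so that only its values on words of length n are meaningful. *)
Definition polya_word (n : nat) (X : choiceType) (s : 'S_n) (w : {fmonom X}) :
    {fmonom X} :=
  if insub (w : seq X) is Some t then
    FMonom [tuple tnth (t : n.-tuple X) (s i) | i < n]
  else w.

Definition polya (K : fieldType) (n : nat) (X : choiceType)
    (phi : permspace K n) (f : freeAlg K X) : freeAlg K X :=
  \sum_(s : 'S_n) \sum_(w <- msupp f) << phi s * f@_w *g polya_word s w >>.

(* Main.v *)
Require Import Defs.
From mathcomp Require Import all_boot all_order all_algebra all_fingroup.
From mathcomp Require Import finmap monalg.
From mathcomp Require Import ring.

Set Implicit Arguments.
Unset Strict Implicit.
Unset Printing Implicit Defensive.

Import GRing.Theory.
Local Open Scope ring_scope.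

(* Cut {1, ..., n} into consecutive blocks and let phi count, with a fixed power
   of 2, the permutations without a peak inside a block. A block without inner
   peak decreases and then increases, and its two halves may be separated on
   either side of the minimum. Hence the coefficient of a word u in phi f is the
   sum, over all ways of cutting each block of u into a ++ b, of the pairing of f
   with the shuffle product of all the words [rev a] and [b].
   A Lie element P is orthogonal to proper shuffles, so for f = P g its letters
   are all peeled off a single word, either off the end of some [a] or off the
   beginning of some [b]. If P has even degree these two contributions have
   opposite signs and cancel, whatever g is. These phi span the peak space by a
   triangularity argument.
   Conversely, taking P = [x, y] and a word of n - 2 further letters shows that
   phi is invariant under exchanging the values 1 and 2. If phi depends only on
   the descent set, this removes, one after the other, all descents that are not
   peaks. *)

(** Pairs [k <= m], listed by [k] and the gap [j = m - k] on the left. This serves both for two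
    prefixes removed in succession and for factors between two cuts. *)
Lemma sum_triangle (R : nmodType) (n : nat) (F : nat -> nat -> R) :
  \sum_(k < n.+1) \sum_(j < (n - k).+1) F k (k + j)%N =
  \sum_(m < n.+1) \sum_(k < m.+1) F k m.
Proof.
elim: n F => [|n IHn] F; first by rewrite !big_ord1.
rewrite [RHS]big_ord_recr /= -IHn big_ord_recr /= subnn big_ord1 addn0.
rewrite [X in _ = _ + X]big_ord_recr /= addrA; congr (_ + _).
rewrite -big_split /=; apply: eq_bigr => k _.
have le_kn : (k <= n)%N by rewrite -ltnS.
rewrite subSn // big_ord_recr /= -subSn // subnKC //; exact: leqW.
Qed.

(** * Peeling letters off families of words *)

Section Peel.

Variables (K : fieldType) (X : choiceType).
Implicit Types (f g : freeAlg K X) (w : seq X) (S T : seq (seq X)).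
Implicit Types (h : seq (seq X) -> K) (p : seq X -> K).

Lemma mcoeff_sum f (w : {fmonom X}) :
  f@_w = \sum_(v <- msupp f) f@_v * (v == w)%:R.
Proof.
rewrite {1}[f]monalgE raddf_sum /=; apply: eq_bigr => v _.
by rewrite mcoeffU mulr_natr.
Qed.

Lemma mcoeffM_cut f g w :
  (f * g)@_(FMonom w) =
  \sum_(k < (size w).+1) f@_(FMonom (take k w)) * g@_(FMonom (drop k w)).
Proof.
rewrite mcoeffMl.
under [RHS]eq_bigr do rewrite (mcoeff_sum f) (mcoeff_sum g) mulr_suml.
rewrite [RHS]exchange_big /=; apply: eq_bigr => u _.
under [RHS]eq_bigr do rewrite mulr_sumr.
rewrite [RHS]exchange_big /=; apply: eq_bigr => v _.
under eq_bigr do rewrite mulrACA.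
rewrite -mulr_sumr -mulr_natr; congr (_ * _).
rewrite fmP fmM /=; under eq_bigr do rewrite !fmP /= -natrM mulnb.
case: eqVneq => [<-|ne].
  have lt_u : (size u < (size (u ++ v)).+1)%N by rewrite size_cat ltnS leq_addr.
  rewrite (bigD1 (Ordinal lt_u)) //= take_size_cat // drop_size_cat // !eqxx.
  rewrite big1 ?addr0 // => k nk; case: eqP => //= def_u.
  case/eqP: nk; apply: val_inj; have := congr1 size def_u.
  by rewrite /= size_takel // -ltnS.
rewrite big1 // => k _; case: eqP => //= def_u; case: eqP => //= def_v.
by rewrite def_u def_v cat_take_drop eqxx in ne.
Qed.

Fixpoint peel1 (x : X) h S : K :=
  if S is s :: S' then
    (if s is y :: s' then (y == x)%:R * h (s' :: S') else 0)
    + peel1 x (fun T => h (s :: T)) S'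
  else 0.

(* The sum of the values of h on what is left of S after removing the letters of
   w, one after the other, each from the front of some word of S. For
   h = [empty_words] below it is the coefficient of w in the shuffle product of
   the words of S. *)
Fixpoint peel w h : seq (seq X) -> K :=
  if w is x :: w' then peel1 x (peel w' h) else h.

Lemma eq_peel1 x h1 h2 : h1 =1 h2 -> peel1 x h1 =1 peel1 x h2.
Proof.
move=> eqh S; elim: S h1 h2 eqh => //= s S IH h1 h2 eqh.
by congr (_ + _); [case: s => // y s; rewrite eqh | apply: IH => T].
Qed.

Lemma eq_peel w h1 h2 : h1 =1 h2 -> peel w h1 =1 peel w h2.
Proof. by move=> eqh; elim: w => //= x w IH; apply: eq_peel1. Qed.

Lemma peel_cat v w h : peel (v ++ w) h =1 peel v (peel w h).
Proof. by elim: v => //= x v IH; apply: eq_peel1. Qed.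

Lemma peel1_sum x (I : Type) (r : seq I) (c : I -> K) (H : I -> _) S :
  peel1 x (fun T => \sum_(i <- r) c i * H i T) S =
  \sum_(i <- r) c i * peel1 x (H i) S.
Proof.
elim: S H => [|s S IH] H /=; first by rewrite big1 // => i _; rewrite mulr0.
rewrite (IH (fun i T => H i (s :: T))).
under [RHS]eq_bigr do rewrite mulrDr.
rewrite big_split /=; congr (_ + _); case: s => [|y s].
  by rewrite big1 // => i _; rewrite mulr0.
by rewrite mulr_sumr; apply: eq_bigr => i _; rewrite mulrCA.
Qed.

Lemma peel_sum w (I : Type) (r : seq I) (c : I -> K) (H : I -> _) S :
  peel w (fun T => \sum_(i <- r) c i * H i T) S =
  \sum_(i <- r) c i * peel w (H i) S.
Proof.
elim: w S => //= x w IH S.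
by rewrite -(peel1_sum _ _ _ (fun i => peel w (H i))); apply: eq_peel1.
Qed.

(** The linear extension of [peel] in its word; for [h = empty_words] it is the pairing of [f] with
    the shuffle product of the words of [S]. *)
Definition peelf f h S : K := mmap idfun (fun w : {fmonom X} => peel w h S) f.

Lemma eq_peelf f h1 h2 : h1 =1 h2 -> peelf f h1 =1 peelf f h2.
Proof. by move=> eqh S; apply: eq_bigr => w _; congr (_ * _); apply: eq_peel. Qed.

Lemma peelfZ a f h S : peelf (a *: f) h S = a * peelf f h S.
Proof.
rewrite /peelf (mmapEw (msuppZ_le _ _)) mmapE mulr_sumr.
by apply: eq_bigr => w _; rewrite /= mcoeffZ mulrA.
Qed.

(** Peeling a concatenation means peeling its two parts in succession, so products become
    compositions. This lets the Lie factor [f] be treated with everything about [g] absorbed into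
    [h]. *)
Lemma peelfM f g h S : peelf (f * g) h S = peelf f (peelf g h) S.
Proof.
rewrite malgME /peelf raddf_sum /=; apply: eq_bigr => v _.
rewrite raddf_sum /= peel_sum mulr_sumr; apply: eq_bigr => w _.
by rewrite mmapU /= fmM peel_cat mulrA.
Qed.

(* Removal of a prefix of a single word of S, a prefix c being weighted by p c:
   the action of a primitive element. *)
Fixpoint prim p h S : K :=
  if S is s :: S' then
    \sum_(k < (size s).+1) p (take k s) * h (drop k s :: S')
    + prim p (fun T => h (s :: T)) S'
  else 0.

Lemma eq_prim p1 p2 h1 h2 : p1 =1 p2 -> h1 =1 h2 -> prim p1 h1 =1 prim p2 h2.
Proof.
move=> eqp eqh S; elim: S h1 h2 eqh => //= s S IH h1 h2 eqh.
by congr (_ + _); [apply: eq_bigr => k _; rewrite eqp eqh | apply: IH => T].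
Qed.

Lemma prim_sum p (I : Type) (r : seq I) (c : I -> K) (H : I -> _) S :
  prim p (fun T => \sum_(i <- r) c i * H i T) S =
  \sum_(i <- r) c i * prim p (H i) S.
Proof.
elim: S H => [|s S IH] H /=; first by rewrite big1 // => i _; rewrite mulr0.
rewrite (IH (fun i T => H i (s :: T))).
under [RHS]eq_bigr do rewrite mulrDr.
rewrite big_split /=; congr (_ + _).
under eq_bigr do rewrite mulr_sumr.
rewrite exchange_big /=; apply: eq_bigr => i _; rewrite mulr_sumr.
by apply: eq_bigr => k _; rewrite mulrCA.
Qed.

Lemma primD p h1 h2 S :
  prim p (fun T => h1 T + h2 T) S = prim p h1 S + prim p h2 S.
Proof.
elim: S h1 h2 => [|s S IH] h1 h2 /=; first by rewrite addr0.
rewrite IH addrACA; congr (_ + _); rewrite -big_split /=.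
by apply: eq_bigr => k _; rewrite mulrDr.
Qed.

Lemma prim_lin a p1 p2 h S :
  prim (fun w => a * p1 w + p2 w) h S = a * prim p1 h S + prim p2 h S.
Proof.
elim: S h => [|s S IH] h /=; first by rewrite mulr0 addr0.
rewrite IH mulrDr addrACA mulr_sumr -big_split; congr (_ + _).
by apply: eq_bigr => k _; rewrite mulrDl mulrA.
Qed.

Local Notation coef f := (fun w => f@_(FMonom w)).

(** Grouping two successive prefixes of [s] by their total length [m = k + j] produces the
    coefficient of the product at [take m s]. *)
Lemma take_prim_mul f g h s S :
  \sum_(k < (size s).+1) f@_(FMonom (take k s)) *
    (\sum_(j < (size (drop k s)).+1)
       g@_(FMonom (take j (drop k s))) * h (drop j (drop k s) :: S)) =
  \sum_(m < (size s).+1) (f * g)@_(FMonom (take m s)) * h (drop m s :: S).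
Proof.
rewrite (eq_bigr (fun k : 'I__ => \sum_(j < (size s - k).+1)
   f@_(FMonom (take k s)) * g@_(FMonom (drop k (take (k + j)%N s)))
    * h (drop (k + j)%N s :: S))) => [|k _]; last first.
  rewrite mulr_sumr size_drop; apply: eq_bigr => j _.
  by rewrite drop_drop take_drop mulrA [(j + k)%N]addnC.
rewrite (sum_triangle _ (fun k m => f@_(FMonom (take k s)) *
   g@_(FMonom (drop k (take m s))) * h (drop m s :: S))).
apply: eq_bigr => m _.
rewrite mcoeffM_cut (size_takel (leq_ord m)) mulr_suml; apply: eq_bigr => k _.
by rewrite take_takel ?leq_ord.
Qed.

(* Operations on different words of S commute, so only the terms removing two
   consecutive prefixes of the same word survive in the commutator. *)
Lemma prim_comm f g h S :
  prim (coef f) (prim (coef g) h) S - prim (coef g) (prim (coef f) h) S =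
  prim (coef (f * g - g * f)) h S.
Proof.
elim: S h => [|s S IH] h /=; first by rewrite subrr.
rewrite !primD !(prim_sum _ _ (fun k : 'I__ => _)).
under eq_bigr do rewrite mulrDr.
rewrite big_split /= (take_prim_mul f g).
under [X in _ - (X + _)]eq_bigr do rewrite mulrDr.
rewrite [X in _ - (X + _)]big_split /= (take_prim_mul g f) -IH.
have -> : \sum_(m < (size s).+1) (f * g - g * f)@_(FMonom (take m s)) * h (drop m s :: S)
  = \sum_(m < (size s).+1) (f * g)@_(FMonom (take m s)) * h (drop m s :: S)
    - \sum_(m < (size s).+1) (g * f)@_(FMonom (take m s)) * h (drop m s :: S).
  by rewrite -sumrB; apply: eq_bigr => m _; rewrite mcoeffB mulrBl.
have aux (a b c d x y : K) : a + c + (d + x) - (b + d + (c + y)) = a - b + (x - y).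
  by ring.
exact: aux.
Qed.

(** Lie elements are primitive: their letters all come off a single word. A letter clearly acts so,
    and [prim_comm] carries the property over to brackets. *)
Lemma peelf_lie f : lie f -> forall h S, peelf f h S = prim (coef f) h S.
Proof.
elim=> [x||a {}f g _ IHf _ IHg|{}f g _ IHf _ IHg] h S.
- rewrite /peelf mmapU /= mul1r.
  rewrite (_ : (fmu x : seq X) = [:: x]) ?fmU //=.
  elim: S h => //= s S IH h; congr (_ + _); last exact: IH.
  have coefE w : (<< fmu x >> : freeAlg K X)@_(FMonom w) = (w == [:: x])%:R.
    by rewrite mcoeffU1 fmP /= fmU eq_sym.
  under eq_bigr do rewrite coefE.
  case: s => [|y s]; first by rewrite big_ord1 /= mul0r.
  rewrite !big_ord_recl /= mul0r add0r take0 drop0 eqseq_cons andbT.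
  rewrite big1 ?addr0 // => i _; rewrite eqseq_cons.
  by case: s i => [|z s] [] //= i _; rewrite andbF mul0r.
- rewrite /peelf mmap0; elim: S h => //= s S IH h.
  by rewrite -IH addr0 big1 // => k _; rewrite mcoeff0 mul0r.
- rewrite /peelf mmapD -!/(peelf _ _ _) peelfZ IHf IHg -prim_lin.
  by apply: eq_prim => // w; rewrite mcoeffD mcoeffZ.
- rewrite /peelf mmapB -!/(peelf _ _ _) !peelfM !(eq_peelf _ (IHf _)).
  rewrite !(eq_peelf _ (IHg _)) IHf IHg.
  exact: prim_comm.
Qed.

(** Reversal with the sign [(-1) ^+ size w] is the antipode, an anti-automorphism that negates
    letters and therefore negates all Lie elements. *)
Lemma lie_rev f : lie f ->
  forall w, f@_(FMonom (rev w)) = (-1) ^+ (size w).+1 * f@_(FMonom w).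
Proof.
have revM f1 f2 : (forall w, f1@_(FMonom (rev w)) = (-1) ^+ (size w).+1 * f1@_(FMonom w)) ->
  (forall w, f2@_(FMonom (rev w)) = (-1) ^+ (size w).+1 * f2@_(FMonom w)) ->
  forall w, (f1 * f2)@_(FMonom (rev w)) = (-1) ^+ (size w) * (f2 * f1)@_(FMonom w).
  move=> H1 H2 w; rewrite !mcoeffM_cut size_rev mulr_sumr (reindex_inj rev_ord_inj).
  apply: eq_bigr => k _ /=; rewrite subSS take_rev drop_rev !subKn ?leq_ord //.
  rewrite H1 H2 mulrACA -exprD size_takel ?leq_ord // size_drop addSn addnS.
  by rewrite subnK ?leq_ord // !exprS !mulN1r opprK; congr (_ * _); rewrite mulrC.
elim=> [x||a {}f g _ IHf _ IHg|{}f g _ IHf _ IHg] w.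
- rewrite !mcoeffU1 !fmP /= !fmU -[[:: x] in LHS]/(rev [:: x]).
  rewrite (inj_eq (can_inj revK)); case: eqP => [<-|] /=; last by rewrite mulr0.
  by rewrite sqrrN expr1n mulr1.
- by rewrite !mcoeff0 mulr0.
- by rewrite !mcoeffD !mcoeffZ IHf IHg mulrDr mulrCA.
- rewrite !mcoeffB !revM // exprS.
  by have aux (e a b : K) : e * b - e * a = -1 * e * (a - b); [ring | exact: aux].
Qed.

End Peel.

(** * Cutting words in two and reversing the left part *)

Section ValleySum.

Variable K : fieldType.

(* The sum of h over all ways of replacing each word u = a ++ b of us by the two
   words [rev a] and b. *)
Fixpoint valley_sum (A : Type) (us : seq (seq A)) (h : seq (seq A) -> K) : K :=
  if us is u :: us' then
    \sum_(m < (size u).+1)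
      valley_sum us' (fun S => h [:: rev (take m u), drop m u & S])
  else h [::].

(** Comparing [h1] and [h2] only on rearrangements of [us] is what later makes [peel_sum_perm]
    applicable. *)
Lemma eq_valley_sum (A : eqType) (us : seq (seq A)) h1 h2 :
  (forall S, perm_eq (flatten S) (flatten us) -> h1 S = h2 S) ->
  valley_sum us h1 = valley_sum us h2 :> K.
Proof.
elim: us h1 h2 => [|u us IH] h1 h2 eqh /=; first exact: eqh.
apply: eq_bigr => m _; apply: IH => S eqS; apply: eqh => /=.
rewrite catA perm_cat // -[X in perm_eq _ X](cat_take_drop m u).
by rewrite perm_cat2r perm_rev.
Qed.

Lemma valley_sum_lin (A : Type) (us : seq (seq A)) (I : Type) (r : seq I)
    (c : I -> K) H :
  valley_sum us (fun T => \sum_(i <- r) c i * H i T) =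
  \sum_(i <- r) c i * valley_sum us (H i).
Proof.
elim: us H => //= u us IH H; under [RHS]eq_bigr do rewrite mulr_sumr.
rewrite exchange_big; apply: eq_bigr => m _.
exact: (IH (fun i S => H i [:: rev (take m u), drop m u & S])).
Qed.

Lemma valley_sumZ (A : Type) (us : seq (seq A)) c H :
  valley_sum us (fun T => c * H T) = c * valley_sum us H.
Proof.
elim: us H => //= u us IH H; rewrite mulr_sumr; apply: eq_bigr => m _.
exact: (IH (fun S => H [:: rev (take m u), drop m u & S])).
Qed.

Lemma valley_sumD (A : Type) (us : seq (seq A)) h1 h2 :
  valley_sum us (fun T => h1 T + h2 T) = valley_sum us h1 + valley_sum us h2.
Proof.
elim: us h1 h2 => //= u us IH h1 h2; rewrite -big_split.
by apply: eq_bigr => m _; rewrite IH.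
Qed.

Lemma valley_sum_map (A : eqType) (B : Type) (e : A -> B) (us : seq (seq A)) h :
  valley_sum (map (map e) us) h = valley_sum us (fun S => h (map (map e) S)).
Proof.
elim: us h => //= u us IH h; rewrite size_map; apply: eq_bigr => m _.
by rewrite IH; apply: eq_valley_sum => S _; rewrite /= map_rev map_take map_drop.
Qed.

(* A prefix of [rev a] and a prefix of b are both factors of u = a ++ b ending or
   starting at the cut; the factor between positions i <= m is removed once with
   the cut at i and once, reversed, with the cut at m. *)
Lemma valley_sum_prim (A : choiceType) (p : seq A -> K) h (us : seq (seq A)) :
  (forall w, p (rev w) = - p w) -> valley_sum us (prim p h) = 0 :> K.
Proof.
move=> p_rev; elim: us h => //= u us IH h.
pose F i m := p (drop i (take m u)) *
  valley_sum us (fun S => h [:: rev (take i u), drop m u & S]).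
transitivity (- (\sum_(m < (size u).+1) \sum_(i < m.+1) F i m)
  + \sum_(m < (size u).+1) \sum_(k < (size u - m).+1) F m (m + k)%N).
  rewrite -sumrN -big_split /=; apply: eq_bigr => m _.
  have le_mu := leq_ord m.
  rewrite !valley_sumD IH addr0 !valley_sum_lin; congr (_ + _).
    rewrite size_rev size_takel // -sumrN (reindex_inj rev_ord_inj).
    apply: eq_bigr => i _ /=; have le_im := leq_ord i.
    rewrite subSS -{1}(size_takel le_mu) take_rev drop_rev.
    rewrite size_takel // !subKn // p_rev mulNr.
    by rewrite take_takel.
  rewrite size_drop; apply: eq_bigr => k _.
  by rewrite /F take_drop drop_drop [(m + k)%N]addnC.
by rewrite sum_triangle addNr.
Qed.

End ValleySum.

(** * Shuffles and permutations *)

Section Shuffle.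

Variable K : fieldType.

Definition empty_words (A : Type) (S : seq (seq A)) : K := (all (@nilp A) S)%:R.

Lemma empty_words_map (A B : Type) (e : A -> B) (S : seq (seq A)) :
  empty_words (map (map e) S) = empty_words S.
Proof.
rewrite /empty_words all_map; congr (nat_of_bool _)%:R.
by apply: eq_all => s; rewrite /nilp /= size_map.
Qed.

Lemma peel1_map (I : finType) (X : choiceType) (e : I -> X) x
    (h : seq (seq X) -> K) (S : seq (seq I)) :
  peel1 x h (map (map e) S) =
  \sum_(y | e y == x) peel1 y (fun T => h (map (map e) T)) S.
Proof.
elim: S h => [|s S IH] h /=; first by rewrite big1.
rewrite big_split /= IH; congr (_ + _).
case: s => [|y s] /=; first by rewrite big1.
rewrite -mulr_suml; congr (_ * _); rewrite -natr_sum; congr _%:R.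
case: eqP => [eyx|neq].
  by rewrite (bigD1 y) ?eyx //= eqxx big1 // => i /andP[_]; rewrite eq_sym => /negbTE->.
by rewrite big1 // => i /eqP eix; case: eqP => // yi; case: neq; rewrite yi.
Qed.

Lemma sum_tuple_cons (I : finType) n (F : seq I -> K) :
  \sum_(t : n.+1.-tuple I) F t = \sum_(x : I) \sum_(t : n.-tuple I) F (x :: t).
Proof.
rewrite pair_big /=.
rewrite (reindex (fun p : I * n.-tuple I => [tuple of p.1 :: p.2])) //=.
exists (fun t => (thead t, [tuple of behead t])) => [[x t]|t] _ /=.
  by congr pair; apply: val_inj.
by rewrite [RHS]tuple_eta; apply: val_inj.
Qed.

(** Words with repeated letters are handled by labelling: the sum runs over all labellings [t] of
    [w], and the labels may be taken distinct in [S]. *)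
Lemma peel_map (I : finType) (X : choiceType) (e : I -> X) (w : seq X)
    (h : seq (seq X) -> K) (S : seq (seq I)) :
  peel w h (map (map e) S) =
  \sum_(t : (size w).-tuple I)
    (map e t == w)%:R * peel t (fun T => h (map (map e) T)) S.
Proof.
elim: w S => [|x w IH] S /=.
  rewrite (eq_bigr (fun => h (map (map e) S))) => [|t _].
    by rewrite sumr_const card_tuple expn0.
  by rewrite (tuple0 t) /= mul1r.
rewrite (sum_tuple_cons _ (fun t => (map e t == x :: w)%:R *
  peel t (fun T => h (map (map e) T)) S)) peel1_map.
rewrite [RHS](bigID (fun y => e y == x)) /= [X in _ + X]big1 ?addr0; last first.
  by move=> y /negbTE ne; rewrite big1 // => t _; rewrite eqseq_cons ne mul0r.
apply: eq_bigr => y /eqP eyx; rewrite (eq_peel1 _ IH).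
rewrite peel1_sum; apply: eq_bigr => t _.
by rewrite eqseq_cons eyx eqxx.
Qed.

Lemma peel1_cat (I : choiceType) (x : I) (h : seq (seq I) -> K) S T :
  peel1 x h (S ++ T) =
  peel1 x (fun U => h (U ++ T)) S + peel1 x (fun U => h (S ++ U)) T.
Proof. by elim: S h => [|s S IH] h /=; rewrite ?add0r // IH addrA. Qed.

Lemma peel1_notin (I : choiceType) (x : I) (h : seq (seq I) -> K) S :
  x \notin flatten S -> peel1 x h S = 0.
Proof.
elim: S h => //= s S IH h; rewrite mem_cat negb_or => /andP[xs xS].
rewrite IH // addr0; case: s xs => //= y s.
by rewrite inE negb_or eq_sym => /andP[/negbTE -> _]; rewrite mul0r.
Qed.

(** With distinct letters at most one word of [S] can lose the next letter of [w], so the peeling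
    never branches and the multiplicity is 0 or 1. *)
Lemma peel_shuffle (I : choiceType) (w : seq I) (S : seq (seq I)) :
  uniq (flatten S) ->
  peel w (@empty_words I) S
  = (perm_eq w (flatten S) && all (fun t => subseq t w) S)%:R.
Proof.
have subseq_notin x w' t : x \notin t -> subseq t (x :: w') = subseq t w'.
  by case: t => [|y t]; rewrite ?sub0seq //= inE negb_or eq_sym => /andP[/negbTE->].
elim: w S => [|x w IH] S uS.
  rewrite /empty_words /=; congr _%:R.
  by elim: S {uS} => //= -[|y s] S IH //=; rewrite andbF.
case: (boolP (x \in flatten S)) => [/flattenP[s sS xs]|xS]; last first.
  rewrite /= peel1_notin //; case: (boolP (perm_eq _ _)) => // /perm_mem/(_ x).
  by rewrite mem_head (negbTE xS).
case/splitPr: sS uS => S1 S2 uS /=.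
have perm_mid u : perm_eq (flatten (S1 ++ u :: S2)) (u ++ flatten (S1 ++ S2)).
  by rewrite !flatten_cat /= perm_catCA.
have /andP[us uS12] : uniq s && uniq (flatten (S1 ++ S2)).
  by move: uS; rewrite (perm_uniq (perm_mid s)) cat_uniq => /and3P[-> _ ->].
have xS12 : x \notin flatten (S1 ++ S2).
  move: uS; rewrite (perm_uniq (perm_mid s)) cat_uniq => /and3P[_ /hasPn dis _].
  by apply: contraL xs => /dis.
have [xS1 xS2] : x \notin flatten S1 /\ x \notin flatten S2.
  by move: xS12; rewrite flatten_cat mem_cat negb_or => /andP[].
rewrite peel1_cat (peel1_notin _ xS1) /= (peel1_notin _ xS2) add0r addr0.
case: s us xs uS => // y s us xs uS.
have [eyx|neyx] := eqVneq y x.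
  rewrite mul1r IH; last first.
    by move: uS; rewrite !(perm_uniq (perm_mid _)) cat_cons => /andP[].
  congr (_%:R); congr (_ && _).
    rewrite (perm_sym w) (perm_sym (x :: w)) !(permPl (perm_mid _)) eyx.
    by rewrite /= perm_cons.
  have eq_all' S0 : x \notin flatten S0 ->
      all (fun t => subseq t (x :: w)) S0 = all (fun t => subseq t w) S0.
    move=> xS0; apply: eq_in_all => t tS0; apply: subseq_notin.
    by apply: contra xS0 => xt; apply/flattenP; exists t.
  rewrite -[(y :: s) :: S2]cat1s -[s :: S2]cat1s !all_cat (eq_all' _ xS1) (eq_all' _ xS2).
  by rewrite /= eyx eqxx.
(* Here [x] stands behind [y] in its word. If that word were a subsequence of [x :: w], then [x]
   would occur again in [w]. *)
rewrite mul0r all_cat /= (negbTE neyx).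
case: (boolP (perm_eq _ _)) => //= pw; rewrite [subseq _ _](_ : _ = false) ?andbF //.
apply/negP => /mem_subseq/(_ x xs) xw.
by move: uS; rewrite -(perm_uniq pw) /= xw.
Qed.

Definition rise n (s : 'S_n) (t : seq 'I_n) : bool :=
  sorted ltn (map (fun i => s i : nat) t).

(** The tuple of the values of [s^-1] lists the positions in the order of their images under [s]; a
    strictly sorted word is recovered from it by filtering. *)
Lemma subseq_rise n (s : 'S_n) (t : seq 'I_n) :
  subseq t [tuple (s^-1)%g i | i < n] = rise s t.
Proof.
pose R := relpre (fun i => s i : nat) ltn.
have trR : transitive R by move=> a b c; apply: ltn_trans.
have sR : sorted R [tuple (s^-1)%g i | i < n].
  rewrite -sorted_map -map_comp.
  rewrite (eq_map (g := val)) => [|i]; last by rewrite /= permKV.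
  by rewrite val_enum_ord iota_ltn_sorted.
rewrite /rise sorted_map; apply/idP/idP => [/subseq_sorted|st]; first exact.
rewrite (irr_sorted_eq trR _ st (sorted_filter trR (mem t) sR)).
- exact: filter_subseq.
- by move=> i; rewrite /R /= ltnn.
move=> i; rewrite mem_filter andb_idr // => _.
by rewrite -{1}[i](permK s); apply: map_f; rewrite mem_enum.
Qed.

Lemma sum_uniq_tuple n (F : seq 'I_n -> K) :
  \sum_(t : n.-tuple 'I_n | uniq t) F t =
  \sum_(s : 'S_n) F [tuple (s^-1)%g i | i < n].
Proof.
(* The default value 1 is taken only on tuples with repetitions, which are excluded from the sum. *)
pose toS (t : n.-tuple 'I_n) : 'S_n := ((insubd (1%g : 'S_n) (finfun (tnth t)))^-1)%g.
rewrite (reindex_onto (fun s : 'S_n => [tuple (s^-1)%g i | i < n]) toS) /=.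
  apply: eq_big => [s|s _] //.
  rewrite map_inj_uniq ?enum_uniq; last exact: perm_inj.
  apply/eqP; rewrite /toS; apply: invg_inj; rewrite invgK; apply: val_inj.
  have -> : finfun (tnth [tuple (s^-1)%g i | i < n]) = val (s^-1)%g.
    by apply/ffunP => i; rewrite ffunE tnth_mktuple pvalE.
  by rewrite valKd.
move=> t ut; apply: eq_from_tnth => i; rewrite tnth_mktuple /toS invgK.
rewrite -pvalE insubdK ?ffunE //; apply/injectiveP => j k.
by rewrite !ffunE; apply: (tuple_uniqP _ ut).
Qed.

(** The passage from shuffles to place permutations: only labellings without repetition survive,
    they are the tuples of inverse permutations, and lying in the shuffle means that [s] rises along
    each word of [S]. *)
Lemma peel_sum_perm n (X : choiceType) (u : 'I_n -> X) (w : n.-tuple X)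
    (S : seq (seq 'I_n)) :
  perm_eq (flatten S) (enum 'I_n) ->
  peel w (@empty_words _) (map (map u) S) =
  \sum_(s : 'S_n) ([forall i, tnth w (s i) == u i] && all (rise s) S)%:R.
Proof.
move=> pS; have uS : uniq (flatten S) by rewrite (perm_uniq pS) enum_uniq.
pose F (t : seq 'I_n) : K :=
  (map u t == w)%:R * peel t (@empty_words _) S.
rewrite peel_map (eq_bigr (fun t : (size w).-tuple 'I_n => F t)) => [|t _]; last first.
  congr (_ * _); apply: eq_peel => T; exact: empty_words_map.
rewrite size_tuple (bigID (fun t : n.-tuple _ => uniq t)) /=.
rewrite [X in _ + X]big1 ?addr0 => [|t /negP nut]; last first.
  rewrite /F peel_shuffle //; case: (boolP (perm_eq _ _)) => pt /=.
    by case: nut; rewrite (perm_uniq pt).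
  by rewrite mulr0.
rewrite sum_uniq_tuple; apply: eq_bigr => s _; rewrite /F peel_shuffle //.
rewrite -natrM mulnb; congr (_%:R); congr (_ && _).
  pose t := [tuple of map u [tuple (s^-1)%g i | i < n]].
  rewrite -[LHS]/(t == w); apply/eqP/forallP => [<- i|eqw].
    by rewrite tnth_map tnth_mktuple permK.
  apply: eq_from_tnth => k; rewrite tnth_map tnth_mktuple.
  by rewrite -(eqP (eqw _)) permKV.
have -> : perm_eq [tuple (s^-1)%g i | i < n] (flatten S).
  rewrite perm_sym (perm_trans pS) // uniq_perm ?enum_uniq //.
    by rewrite map_inj_uniq ?enum_uniq //; apply: perm_inj.
  by move=> i; rewrite mem_enum -[i](permK s); apply/esym/map_f; rewrite mem_enum.
by apply: eq_all => t; rewrite subseq_rise.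
Qed.

End Shuffle.

(** * Blocks without inner peaks *)

Fixpoint nopeak (t : seq nat) : bool :=
  if t is a :: t' then
    nopeak t' && (if t' is b :: c :: _ then ~~ ((a < b) && (c < b))%N else true)
  else true.

Lemma nopeak_ltn a b t :
  uniq [:: a, b & t] -> (a < b)%N -> nopeak [:: a, b & t] = sorted ltn (b :: t).
Proof.
elim: t a b => [|c t IH] a b // uabt lt_ab; have := uabt.
rewrite cons_uniq => /andP[_ ubt].
have -> : nopeak [:: a, b, c & t] =
  nopeak [:: b, c & t] && ~~ ((a < b) && (c < b))%N by [].
have neq_bc : b != c by move: ubt; rewrite /= inE negb_or => /andP[/andP[]].
rewrite lt_ab andTb -leqNgt; case: (ltnP b c) => [lt_bc|]; last first.
  rewrite leq_eqVlt eq_sym (negbTE neq_bc) /= => lt_cb.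
  by rewrite [(b <= c)%N]leqNgt lt_cb andbF [(b < c)%N]ltnNge (ltnW lt_cb).
by rewrite IH // (ltnW lt_bc) andbT /= lt_bc.
Qed.

Definition valley_cut (t : seq nat) (m : nat) : bool :=
  sorted ltn (rev (take m t)) && sorted ltn (drop m t).

(** A word without peaks decreases to its minimum and increases afterwards. The cut may fall just
    before or just after the minimum, whence the factor 2. *)
Lemma sum_valley_cut t : uniq t -> t != [::] ->
  (\sum_(m < (size t).+1) valley_cut t m)%N = (2 * nopeak t)%N.
Proof.
case: t => // a t; elim: t a => [|b t IH] a uat _.
  by rewrite !big_ord_recl big_ord0.
have cutS x v m : valley_cut (x :: v) m.+1 =
    path gtn x (take m v) && sorted ltn (drop m v).
  by rewrite /valley_cut rev_sorted.
have cut0 x v : valley_cut (x :: v) 0 = path ltn x v by [].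
have ubt : uniq (b :: t) by case/andP: uat.
have neq_ab : a != b by move: uat; rewrite /= inE negb_or => /andP[/andP[]].
have {IH} := IH b ubt isT.
have splitS v N :
    (\sum_(m < N.+1) valley_cut v m
     = valley_cut v 0 + \sum_(m < N) valley_cut v m.+1)%N.
  by rewrite big_ord_recl.
rewrite !splitS [size [:: a, b & t]]/= [in X in _ -> X]big_ord_recl.
rewrite /=.
rewrite !cut0 cutS take0 drop0.
under eq_bigr do rewrite cutS.
under [in X in _ -> X]eq_bigr do rewrite cutS.
(* If [a < b], only the cuts before and after [a] can count, and both require [b :: t] to
   increase. *)
have [lt_ab _|] := ltnP a b.
  have := nopeak_ltn uat lt_ab; rewrite /= lt_ab /= => ->.
  rewrite big1 => [|i _]; last by rewrite ltnNge (ltnW lt_ab).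
  by rewrite mul2n -addnn addn0.
(* If [b < a], the cut before [a] fails and the others are those of [b :: t], shifted by one. *)
rewrite leq_eqVlt eq_sym (negbTE neq_ab) /= => lt_ba IH.
rewrite ltnNge (ltnW lt_ba) lt_ba add0n IH.
by congr (2 * nat_of_bool _)%N; case: (t) => [|? ?]; rewrite ?andbT.
Qed.

Section Blocks.

Variables (n : nat) (E : {set 'I_n}).

(* Cuts t after each element of E. *)
Fixpoint blocks (t : seq 'I_n) : seq (seq 'I_n) :=
  if t is i :: t' then
    if blocks t' is b :: bs then
      if i \in E then [:: i] :: b :: bs else (i :: b) :: bs
    else [:: [:: i]]
  else [::].

Lemma flatten_blocks t : flatten (blocks t) = t.
Proof.
elim: t => //= i t; case: (blocks t) => [|b bs] /=; first by move=> <-.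
by case: ifP => _ /= <-.
Qed.

Lemma blocks_neq0 t : all (fun b => b != [::]) (blocks t).
Proof.
elim: t => //= i t; case: (blocks t) => [|b bs] //=.
by case: ifP => _ //= /andP[_ ->].
Qed.

(** A peak in the middle of three consecutive letters is broken up by a cut after the first or after
    the second of them, and by no other cut. *)
Lemma nopeak_blocks (r : 'I_n -> nat) t :
  reflect (forall i0 k, (k.+2 < size t)%N ->
    (r (nth i0 t k) < r (nth i0 t k.+1))%N ->
    (r (nth i0 t k.+2) < r (nth i0 t k.+1))%N ->
    (nth i0 t k \in E) || (nth i0 t k.+1 \in E))
  (all (fun b => nopeak (map r b)) (blocks t)).
Proof.
pose q h (t' : seq 'I_n) := if t' is i :: j :: _ then
  (r h < r i)%N && (r j < r i)%N ==> (h \in E) || (i \in E) else true.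
have blocksS h t' : all (fun b => nopeak (map r b)) (blocks (h :: t')) =
    q h t' && all (fun b => nopeak (map r b)) (blocks t').
  case: t' => [|i t'] //.
  have blocks_cons j v : exists b bs, blocks (j :: v) = (j :: b) :: bs.
    rewrite /=; case: (blocks v) => [|b bs]; first by exists [::], [::].
    by case: ifP => _; [exists [::], (b :: bs) | exists b, bs].
  case: t' => [|j t'].
    by rewrite /=; case: (h \in E).
  have [b [bs def_b]] := blocks_cons j t'.
  rewrite [blocks [:: h, i, j & t']]/= -/(blocks (j :: t')).
  rewrite [blocks [:: i, j & t']]/= -/(blocks (j :: t')) def_b /q.
  case: (h \in E); case: (i \in E); rewrite ?implybT // implybF.
  have aux (x y z : bool) : (x && y) && z = y && (x && z) by case: x; case: y.
  exact: aux.
apply: (iffP idP) => [|H].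
  elim: t => // h t IH; rewrite blocksS => /andP[qh /IH{}IH] i0 [|k] /=; last first.
    by rewrite ltnS; apply: IH.
  case: t qh {IH} => [|i [|j t]] //= qh _ lt_hi lt_ji.
  by rewrite lt_hi lt_ji in qh.
elim: t H => // h t IH H; rewrite blocksS IH ?andbT => [|i0 k lt_k]; last first.
  exact: (H i0 k.+1).
case: t {IH} H => [|i [|j t]] //= H; apply/implyP => /andP[lt_hi lt_ji].
exact: (H h 0%N).
Qed.

End Blocks.

Lemma rise_rev n (s : 'S_n) t m :
  rise s (rev (take m t)) && rise s (drop m t)
  = valley_cut (map (fun i => s i : nat) t) m.
Proof. by rewrite /rise map_rev map_take map_drop. Qed.

(** The cuts of different blocks are independent, and by [sum_valley_cut] each block admits two of
    them or none. *)
Lemma valley_sum_rise (K : fieldType) n (s : 'S_n) (us : seq (seq 'I_n)) :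
  all (fun b => b != [::]) us -> uniq (flatten us) ->
  valley_sum us (fun S => (all (rise s) S)%:R) =
  2 ^+ size us * (all (fun b => nopeak (map (fun i => s i : nat) b)) us)%:R :> K.
Proof.
elim: us => [|b us IH] /=; first by rewrite mul1r.
case/andP=> b0 us0; rewrite cat_uniq => /and3P[ub _ uus].
pose ms := map (fun i => s i : nat) b.
have ums : uniq ms by rewrite map_inj_uniq // => i j /val_inj/perm_inj.
have ms0 : ms != [::] by rewrite /ms; case: (b) b0.
have := congr1 (fun k => k%:R : K) (sum_valley_cut ums ms0).
rewrite /= natr_sum natrM size_map => sum_ms.
rewrite (eq_bigr (fun m : 'I_(size b).+1 => (valley_cut ms m)%:R *
   (2 ^+ size us * (all (fun b => nopeak (map (fun i => s i : nat) b)) us)%:R))).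
  by rewrite -mulr_suml sum_ms mulrACA -natrM mulnb exprS.
move=> m _; rewrite -IH // -valley_sumZ; apply: eq_valley_sum => S _ /=.
by rewrite andbA -rise_rev -natrM mulnb.
Qed.

(** A cut after [h] makes [h] the last and [h.+1] the first position of a block, the two places
    where a peak is not inside a block. *)
Definition near_set n (E : {set 'I_n}) : {set 'I_n} :=
  [set i : 'I_n | (i \in E) || [exists h in E, i == h.+1 :> nat]].

Lemma nopeak_blocks_enum n (E : {set 'I_n}) (s : 'S_n) :
  all (fun b => nopeak (map (fun i => s i : nat) b)) (blocks E (enum 'I_n))
  = (Peak s \subset near_set E).
Proof.
apply/nopeak_blocks/subsetP => [H i|H i0 k].
  rewrite !inE => /existsP[h /existsP[j /and4P[/eqP ih /eqP ji lt_hi lt_ji]]].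
  have nthE (x : 'I_n) : nth i (enum 'I_n) x = x by exact: nth_ord_enum.
  have := H i h; rewrite size_enum_ord -ih -ji !nthE ltn_ord lt_hi lt_ji.
  move=> /(_ isT isT isT) /orP[hE|->] //; apply/orP; right.
  by apply/existsP; exists h; rewrite hE ih /=.
rewrite size_enum_ord => lt_k2.
have lt_k1 := ltnW lt_k2; have lt_k0 := ltnW lt_k1.
have nthE l (lt_l : (l < n)%N) : nth i0 (enum 'I_n) l = Ordinal lt_l.
  exact: (nth_ord_enum i0 (Ordinal lt_l)).
rewrite !nthE => lt_hi lt_ji.
have : Ordinal lt_k1 \in Peak s.
  rewrite inE; apply/existsP; exists (Ordinal lt_k0).
  by apply/existsP; exists (Ordinal lt_k2); rewrite !eqxx lt_hi lt_ji.
move/H; rewrite inE => /orP[-> | /existsP[h /andP[hE /eqP/= [kh]]]]; first by rewrite orbT.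
by rewrite (_ : Ordinal lt_k0 = h) ?hE //; apply: val_inj.
Qed.

(** * A weight for the triangularity of peak sets *)

Section Triangular.

Variable n : nat.
Implicit Types (E P Q : {set 'I_n}) (s : 'S_n).

(** Each position has positive weight, and the weight grows when a position moves to the left. *)
Definition weight P : nat := \sum_(i in P) (n - i).

Lemma Peak_sparse s (i j : 'I_n) :
  i \in Peak s -> j = i.+1 :> nat -> j \notin Peak s.
Proof.
rewrite inE => /existsP[h /existsP[j' /and4P[_ /eqP ji _ lt_ji]]] ji'.
have -> : j = j' by apply: val_inj; rewrite /= ji.
rewrite inE; apply/existsP => -[h' /existsP[k /and4P[/eqP jh _ lt_ij _]]].
have eh : h' = i by apply: val_inj; apply: succn_inj; rewrite -jh ji.
by rewrite eh ltnNge (ltnW lt_ji) in lt_ij.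
Qed.

(* Peaks are never adjacent, so [i |-> i] or [i |-> i - 1] maps the peak set
   injectively into E. *)
Lemma weight_Peak s E :
  Peak s \subset near_set E -> Peak s != E -> (weight (Peak s) < weight E)%N.
Proof.
set P := Peak s => sPE neqPE.
pose f (i : 'I_n) := if i \in E then i else
  odflt i [pick h in E | i == h.+1 :> nat].
have fE i : i \in P -> f i \in E /\ (i = f i \/ i = (f i).+1 :> nat).
  move=> iP; have := subsetP sPE i iP; rewrite inE /f.
  case: ifP => [iE _|_ /= /existsP[h /andP[hE ih]]]; first by split; [|left].
  case: pickP => [h' /andP[h'E /eqP ih']|/(_ h)]; last by rewrite hE ih.
  by split; [|right].
have injf : {in P &, injective f}.
  move=> i j iP jP eq_f.
  have [_ fi] := fE i iP; have [_ fj] := fE j jP; rewrite -eq_f in fj.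
  case: fi => fi; case: fj => fj.
  - by rewrite fi fj.
  - by have/negP[] := Peak_sparse iP (etrans fj (congr1 (fun l : 'I_n => l.+1) (esym fi))).
  - by have/negP[] := Peak_sparse jP (etrans fi (congr1 (fun l : 'I_n => l.+1) (esym fj))).
  - by apply: val_inj; rewrite /= fi fj.
have le_f i : i \in P -> (n - i <= n - f i)%N.
  by move=> /fE[_ [<-//|->]]; apply: leq_sub2l; apply: leqW.
have sfE : f @: P \subset E by apply/subsetP => _ /imsetP[i /fE[? _] ->].
have wE : (weight E = \sum_(i in P) (n - f i) + weight (E :\: f @: P))%N.
  rewrite /weight (big_setID (f @: P)) /= (setIidPr sfE) big_imset //.
(* If [f] moves no peak, the peak set is a proper subset of [E], and a missing element makes the
   inequality strict; otherwise a moved peak does. *)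
have [fid|] := boolP [forall i in P, f i == i].
  have fP : f @: P = P.
    rewrite -[RHS]imset_id; apply: eq_in_imset => i iP; exact/eqP/(forall_inP fid).
  rewrite wE fP (eq_bigr (fun i : 'I_n => n - i)%N) => [|i iP]; last first.
    by rewrite (eqP (forall_inP fid i iP)).
  rewrite -/(weight P) -[X in (X < _)%N]addn0 ltn_add2l lt0n.
  have /set0Pn[i iEP] : E :\: P != set0.
    by rewrite setD_eq0; apply: contra neqPE => sEP; rewrite eqEsubset sEP -{1}fP sfE.
  by rewrite /weight (bigD1 i) //= addn_eq0 negb_and subn_eq0 -ltnNge ltn_ord.
rewrite negb_forall_in => /exists_inP[i iP neq_fi].
rewrite wE; apply: leq_trans (leq_addr _ _).
rewrite /weight (bigD1 i) //= [X in (_ < X)%N](bigD1 i) //= -addSn.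
apply: leq_add; last by apply: leq_sum => j /andP[/le_f].
have [_ [fi|->]] := fE i iP; first by rewrite -fi eqxx in neq_fi.
by rewrite ltn_sub2l.
Qed.

End Triangular.

(** * Place permutations *)

Section Polya.

Variables (K : fieldType) (X : choiceType).
Implicit Types (f g : freeAlg K X).

Lemma homogeneousM a b f g :
  homogeneous a f -> homogeneous b g -> homogeneous (a + b) (f * g).
Proof.
by move=> hf hg w /msuppM_le[u [v [/hf <- /hg <- ->]]]; rewrite fdegM.
Qed.

Lemma homogeneous_prod k (m : 'I_k -> nat) (P : 'I_k -> freeAlg K X) :
  (forall i, homogeneous (m i) (P i)) ->
  homogeneous (\sum_(i < k) m i) (\prod_(i < k) P i).
Proof.
move=> hP; apply: (big_ind2 (fun d f => homogeneous d f)) => //.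
  by move=> w; rewrite msuppU1 inE => /eqP ->; rewrite fdeg1.
by move=> a f b g; apply: homogeneousM.
Qed.

Variable n : nat.
Implicit Types (phi : permspace K n).

Lemma polya_word_tuple (s : 'S_n) (w : n.-tuple X) :
  polya_word s (FMonom w) = FMonom [tuple tnth w (s i) | i < n].
Proof. by rewrite /polya_word /= valK. Qed.

Lemma size_polya_word (s : 'S_n) (w : {fmonom X}) : fdeg (polya_word s w) = fdeg w.
Proof.
rewrite /polya_word; case: insubP => //= t _ eq_t.
by rewrite !fdegE /= -eq_t size_map size_enum_ord size_tuple.
Qed.

Lemma mcoeff_polya phi f u :
  (polya phi f)@_u =
  \sum_s phi s * \sum_(w <- msupp f) f@_w * (polya_word s w == u)%:R.
Proof.
rewrite /polya raddf_sum /=; apply: eq_bigr => s _.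
rewrite raddf_sum mulr_sumr /=; apply: eq_bigr => w _.
by rewrite mcoeffU mulrA mulr_natr.
Qed.

Lemma polyaD phi psi f : polya (phi + psi) f = polya phi f + polya psi f.
Proof.
apply/malgP => u; rewrite mcoeffD !mcoeff_polya -big_split /=.
by apply: eq_bigr => s _; rewrite ffunE mulrDl.
Qed.

Lemma polya0 f : polya (0 : permspace K n) f = 0.
Proof.
apply/malgP => u; rewrite mcoeff_polya mcoeff0 big1 // => s _.
by rewrite ffunE mul0r.
Qed.

Lemma polya_sum (I : Type) (r : seq I) (Q : pred I) (F : I -> permspace K n) f :
  polya (\sum_(i <- r | Q i) F i) f = \sum_(i <- r | Q i) polya (F i) f.
Proof.
exact: (big_morph (fun phi => polya phi f) (fun phi psi => polyaD phi psi f) (polya0 f)).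
Qed.

Lemma polyaZ a phi f : polya (a *: phi) f = a *: polya phi f.
Proof.
apply/malgP => u; rewrite mcoeffZ !mcoeff_polya mulr_sumr.
by apply: eq_bigr => s _; rewrite ffunE -mulrA.
Qed.

Definition near_sum (E : {set 'I_n}) : permspace K n :=
  [ffun s => (Peak s \subset near_set E)%:R].

Lemma near_sumE E :
  near_sum E = \sum_(P : {set 'I_n} | P \subset near_set E) peak_sum K P.
Proof.
apply/ffunP => s; rewrite sum_ffunE ffunE; under eq_bigr do rewrite ffunE.
case: (boolP (_ \subset _)) => sub.
  rewrite (bigD1 (Peak s)) //= eqxx big1 ?addr0 // => P /andP[_].
  by rewrite eq_sym => /negbTE ->.
by rewrite big1 // => P sP; case: eqP => // eP; rewrite eP sP in sub.
Qed.

(** Induction on the weight: [near_sum P] is [peak_sum K P] plus terms for other sets [Q], which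
    either are peak sets of smaller weight or have zero peak sum. *)
Lemma polya_peak_sum f :
  (forall E : {set 'I_n}, polya (near_sum E) f = 0) ->
  forall P : {set 'I_n}, polya (peak_sum K P) f = 0.
Proof.
move=> near0 P; have [m] := ubnP (weight P); elim: m P => // m IH P le_m.
have := near0 P; rewrite near_sumE (bigD1 P) /=; last first.
  by apply/subsetP => i iP; rewrite inE iP.
rewrite polyaD polya_sum big1 ?addr0 // => Q /andP[sQE neQP].
have [/existsP[s /eqP PQ]|/existsPn noQ] := boolP [exists s : 'S_n, Peak s == Q].
  apply: IH; rewrite -PQ in sQE neQP *.
  exact: leq_trans (weight_Peak sQE neQP) le_m.
apply/malgP => u; rewrite mcoeff_polya mcoeff0 big1 // => s _.
by rewrite ffunE (negbTE (noQ s)) mul0r.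
Qed.

(** Up to the factor [2 ^+ size us], each coefficient is the valley sum of the pairing of [f * g]
    with shuffle products, and [valley_sum_prim] makes it vanish. *)
Lemma polya_near_sum_lie (two_neq0 : 2 != 0 :> K) E f g q :
  lie f -> homogeneous q f -> ~~ odd q -> homogeneous n (f * g) ->
  polya (near_sum E) (f * g) = 0.
Proof.
move=> lf hf q_even hfg; set F := f * g.
set us := blocks E (enum 'I_n).
have flat_us : flatten us = enum 'I_n by rewrite flatten_blocks.
apply/malgP => u; rewrite mcoeff0 mcoeff_polya.
have [sz_u|neq_u] := eqVneq (size u) n; last first.
  rewrite big1 // => s _; rewrite big_seq big1 ?mulr0 // => w /hfg sz_w.
  case: eqP => [eq_w|]; last by rewrite mulr0.
  by rewrite -eq_w -fdegE size_polya_word sz_w eqxx in neq_u.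
have {sz_u}[t ->] : exists t : n.-tuple X, u = FMonom t.
  by exists (Tuple (introT eqP sz_u)); rewrite fmK.
apply: (mulfI (expf_neq0 (size us) two_neq0)); rewrite mulr0 mulr_sumr.
transitivity (valley_sum (map (map (tnth t)) us)
    (fun S => \sum_(w <- msupp F)
      F@_w * peel (w : {fmonom X}) (@empty_words K X) S)); last first.
  (* The factor [f] acts through [prim] on the function given by peeling [g]. Its coefficients are
     antisymmetric under reversal: by [lie_rev] on words of even length, and trivially on odd ones,
     where they are 0. *)
  rewrite -[RHS](@valley_sum_prim K X (fun w => f@_(FMonom w))
    (peelf g (@empty_words K X)) (map (map (tnth t)) us)) => [|w].
    apply: eq_valley_sum => S _.
    by rewrite -[LHS]/(peelf F (@empty_words K X) S) peelfM peelf_lie.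
  rewrite (lie_rev lf) exprS mulN1r mulNr -signr_odd.
  case: (boolP (odd _)) => odd_w; last by rewrite mul1r.
  rewrite mulN1r; have [->|] := eqVneq f@_(FMonom w) 0; first by rewrite !oppr0.
  by rewrite mcoeff_neq0 => /hf sz_w; move: q_even; rewrite -sz_w /fdeg /= odd_w.
rewrite valley_sum_lin.
transitivity (\sum_(w <- msupp F) F@_w * \sum_s
    (polya_word s w == FMonom t)%:R * (2 ^+ size us * near_sum E s)).
  under [RHS]eq_bigr do rewrite mulr_sumr.
  rewrite [RHS]exchange_big; apply: eq_bigr => s _; rewrite mulrA mulr_sumr.
  by apply: eq_bigr => w _; rewrite mulrC -mulrA.
(* It remains to compare the two sides for each word [w] of [f * g], which has length [n]. *)
rewrite big_seq [RHS]big_seq; apply: eq_bigr => w /hfg sz_w; congr (_ * _).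
have [v ->] : exists v : n.-tuple X, w = FMonom v.
  by exists (Tuple (introT eqP sz_w)); rewrite fmK.
rewrite valley_sum_map.
rewrite (@eq_valley_sum _ _ _ _ (fun S => \sum_s
  (polya_word s (FMonom v) == FMonom t)%:R * (all (rise s) S)%:R)); last first.
  move=> S pS; rewrite peel_sum_perm -?flat_us //; apply: eq_bigr => s _.
  rewrite -natrM mulnb polya_word_tuple; congr (nat_of_bool (_ && _))%:R.
  rewrite fmP /= -[RHS]/([tuple tnth v (s i) | i < n] == t).
  apply/forallP/eqP => [eq_vt|<- i]; last by rewrite tnth_mktuple.
  by apply: eq_from_tnth => i; rewrite tnth_mktuple (eqP (eq_vt i)).
rewrite valley_sum_lin; apply: eq_bigr => s _; congr (_ * _).
by rewrite valley_sum_rise ?blocks_neq0 ?flat_us ?enum_uniq // nopeak_blocks_enum ffunE.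
Qed.

End Polya.

(** * Descents, peaks and the exchange of the two smallest values *)

Section Span.

Variables (K : fieldType) (n : nat).
Implicit Types (phi : permspace K n) (s : 'S_n).

Lemma span_ind (V : vectType K) (Q : V -> Prop) (X : seq V) :
  Q 0 -> (forall a u v, Q u -> Q v -> Q (a *: u + v)) ->
  (forall u, u \in X -> Q u) -> forall v, v \in <<X>>%VS -> Q v.
Proof.
move=> Q0 Qlin QX v /(@coord_span _ _ _ (in_tuple X)) ->.
apply: big_ind => // [u w Qu Qw|i _]; first by rewrite -[u]scale1r; apply: Qlin.
by rewrite -[_ *: _]addr0; apply: Qlin => //; apply/QX/mem_nth.
Qed.

Lemma descent_space_Des phi s1 s2 :
  phi \in descent_space K n -> Des s1 = Des s2 -> phi s1 = phi s2.
Proof.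
move=> phiD eq_Des; move: phi phiD.
apply: span_ind => [|a u v Hu Hv|_ /mapP[D _ ->]]; first by rewrite !ffunE.
- by rewrite !ffunE Hu Hv.
- by rewrite !ffunE eq_Des.
Qed.

Lemma mem_peak_space phi :
  (forall s1 s2, Peak s1 = Peak s2 -> phi s1 = phi s2) ->
  phi \in peak_space K n.
Proof.
move=> phi_Peak.
(* If [P] is not a peak set, the default coefficient 0 is harmless because [peak_sum K P] is
   zero. *)
pose c (P : {set 'I_n}) : K := if [pick s : 'S_n | Peak s == P] is Some s then phi s else 0.
pose interior := [set i : 'I_n | (0 < i)%N && (i.+1 < n)%N].
have -> : phi = \sum_(P in powerset interior) c P *: peak_sum K P.
  apply/ffunP => s; rewrite sum_ffunE (bigD1 (Peak s)) /=; last first.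
    rewrite powersetE; apply/subsetP => i; rewrite !inE.
    case/existsP=> h /existsP[j /and4P[/eqP-> /eqP <- _ _]]; exact: ltn_ord.
  rewrite big1 => [|P /andP[_]]; last first.
    by rewrite !ffunE eq_sym => /negbTE->; rewrite scaler0.
  rewrite addr0 !ffunE eqxx /c; case: pickP => [s' /eqP/phi_Peak ->|/(_ s)].
    by rewrite -[LHS]mulr1.
  by rewrite eqxx.
apply: memv_suml => P sP; apply/memvZ/memv_span.
by apply/mapP; exists P; rewrite // mem_enum.
Qed.

End Span.

Section Toggle.

Variable n : nat.
Implicit Types (s : 'S_n) (h i j k : 'I_n).

Lemma mem_Des s i j : j = i.+1 :> nat -> (i \in Des s) = (s j < s i)%N.
Proof.
move=> ji; rewrite inE; apply/existsP/idP => [[k /andP[/eqP ki]]|lt_ji].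
  by rewrite (_ : k = j) //; apply: val_inj; rewrite /= ki ji.
by exists j; rewrite ji eqxx.
Qed.

Lemma Des_succ s i : i \in Des s -> exists j, j = i.+1 :> nat.
Proof. by rewrite inE => /existsP[j /andP[/eqP ji _]]; exists j. Qed.

Lemma mem_Peak s h i : i = h.+1 :> nat ->
  (i \in Peak s) = (i \in Des s) && (h \notin Des s).
Proof.
move=> ih; rewrite (mem_Des s ih) !inE -leqNgt; apply/existsP/andP.
  case=> h' /existsP[j /and4P[/eqP ih' ji lt_hi lt_ji]].
  have -> : h = h' by apply: val_inj; apply: succn_inj; rewrite -ih.
  by split; [apply/existsP; exists j; rewrite ji | apply: ltnW].
case=> /existsP[j /andP[ji lt_ji]] le_hi; exists h; apply/existsP; exists j.
apply/and4P; split=> //; first exact/eqP.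
rewrite ltn_neqAle le_hi andbT.
by apply/eqP => /val_inj/perm_inj hi; move: ih; rewrite hi => /n_Sn.
Qed.

Lemma Peak_pred s i : i \in Peak s -> exists h, i = h.+1 :> nat.
Proof. by rewrite inE => /existsP[h /existsP[j /and4P[/eqP ? _ _ _]]]; exists h. Qed.

Lemma Peak_sub_Des s : Peak s \subset Des s.
Proof.
by apply/subsetP => i iP; have [h /mem_Peak E] := Peak_pred iP; move: iP; rewrite E => /andP[].
Qed.

Lemma ltn_rank (key : 'I_n -> nat) i j :
  (#|[set k | (key k < key i)%N]| < #|[set k | (key k < key j)%N]|)%N
  = (key i < key j)%N.
Proof.
case: (ltnP (key i) (key j)) => [lt_ij|le_ji]; last first.
  rewrite ltnNge subset_leq_card //; apply/subsetP => k; rewrite !inE => /leq_trans; exact.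
apply/proper_card/properP; split.
  by apply/subsetP => k; rewrite !inE => /ltn_trans; apply.
by exists i; rewrite !inE ?ltnn.
Qed.

(** Ranks compare as the keys do, so any prescribed relative order of the positions is realized by a
    permutation. *)
Lemma standardization (key : 'I_n -> nat) : injective key ->
  exists s, forall i, s i = #|[set j | (key j < key i)%N]| :> nat.
Proof.
move=> injk; pose rk i := #|[set j | (key j < key i)%N]|.
have rk_lt i : (rk i < n)%N.
  rewrite -[X in (_ < X)%N]card_ord -cardsT; apply/proper_card/properP; split=> //.
  by exists i; rewrite !inE ?ltnn.
have inj_rk : injective (fun i => Ordinal (rk_lt i)).
  move=> i j [eq_rk]; apply: injk; have := ltn_rank key i j.
  have := ltn_rank key j i; rewrite -!/(rk _) eq_rk ltnn.
  by case: ltngtP.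
by exists (perm inj_rk) => i; rewrite permE.
Qed.

Lemma eq_Des s1 s2 :
  (forall i j, j = i.+1 :> nat -> (s1 j < s1 i)%N = (s2 j < s2 i)%N) ->
  Des s1 = Des s2.
Proof.
move=> H; apply/setP => i; have [lt_i|ge_i] := ltnP i.+1 n.
  by rewrite !(@mem_Des _ i (Ordinal lt_i)) // H.
have noDes s : (i \in Des s) = false.
  by apply/negP => /Des_succ[j ji]; rewrite -ji leqNgt ltn_ord in ge_i.
by rewrite !noDes.
Qed.

(** No value lies between 0 and 1, so their exchange affects only the comparison of these two. *)
Lemma tperm01_ltn (a b i j : 'I_n) : a = 0%N :> nat -> b = 1%N :> nat ->
  ~~ ((i == a) && (j == b)) -> ~~ ((i == b) && (j == a)) ->
  (tperm a b i < tperm a b j)%N = (i < j)%N.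
Proof.
move=> a0 b1 nab nba.
have gt1 k : k <> a -> k <> b -> (1 < k)%N.
  move=> ka kb; rewrite ltnNge; apply/negP; rewrite leq_eqVlt ltnS leqn0.
  by case/orP=> /eqP Hk; [apply: kb | apply: ka]; apply: val_inj; rewrite /= Hk ?a0 ?b1.
case: tpermP nab nba => [->|->|ia ib]; case: tpermP => [->|->|ja jb];
  rewrite ?eqxx ?ltnn // => _ _; rewrite ?a0 ?b1 //.
- by rewrite (gt1 j) ?(ltnW (gt1 j _ _)).
- by rewrite (gt1 j) ?(ltnW (gt1 j _ _)).
- by rewrite ltn0 ltnNge (ltnW (gt1 i _ _)).
- by rewrite ltn0 ltnNge (ltnW (gt1 i _ _)).
Qed.

(* The values 0 and 1 can be moved to the positions [i] and [i.+1] without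
   changing any descent; exchanging them then removes the descent [i]. *)
Lemma remove_descent s i (a b : 'I_n) : a = 0%N :> nat -> b = 1%N :> nat ->
  i \in Des s -> i \notin Peak s -> (forall j, j = i.+1 :> nat -> j \notin Des s) ->
  exists2 s', Des s' = Des s & Des (s' * tperm a b)%g = Des s :\ i.
Proof.
move=> a0 b1 iD iNP jND; have [j ji] := Des_succ iD; have {}jND := jND j ji.
have neq_ij : i == j = false by apply/eqP => ij; move: ji; rewrite -ij => /n_Sn.
(* The position [j] gets the smallest key and [i] the next; the other values keep their order,
   shifted by 2 to stay above. *)
pose key k : nat := if k == j then 0 else if k == i then 1 else (s k).+2.
have injk : injective key.
  move=> k l; rewrite /key; have [->|_] := eqVneq k j.
    by have [->|_] := eqVneq l j; rewrite // ; case: (l == i).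
  have [->|_] := eqVneq l j; first by case: (k == i).
  have [->|_] := eqVneq k i; first by have [->|] := eqVneq l i.
  by have [->|_] := eqVneq l i => // -[] /val_inj/perm_inj.
have [s' rk_s'] := standardization injk.
have lt_s' k l : (s' k < s' l)%N = (key k < key l)%N by rewrite !rk_s' ltn_rank.
have s'j : s' j = a.
  apply: val_inj; rewrite /= rk_s' a0; apply: eq_card0 => k.
  by rewrite inE /key eqxx.
have s'i : s' i = b.
  apply: val_inj; rewrite /= rk_s' b1 -(cards1 j); congr #|pred_of_set _|.
  apply/setP => k; rewrite !inE {2}/key neq_ij eqxx /key.
  by case: (k == j) => //; case: (k == i).
(* Lowering [i] and [j] is harmless: the position before [i], if any, is already a descent because
   [i] is no peak, and [j] is no descent. *)
have DesE : Des s' = Des s.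
  apply: eq_Des => k l lk; rewrite lt_s' -(mem_Des s lk) /key.
  have [kj|neq_kj] := eqVneq k j.
    by rewrite kj (negbTE jND).
  have [ki|neq_ki] := eqVneq k i.
    rewrite ki iD (_ : l = j) ?eqxx //; apply: val_inj; by rewrite /= lk ki ji.
  have [lj|_] := eqVneq l j.
    case/eqP: neq_ki; apply: val_inj; apply: succn_inj; by rewrite /= -lk lj ji.
  have [li|_] := eqVneq l i; last by rewrite !ltnS (mem_Des s lk).
  by move: iNP; rewrite -li (mem_Peak s lk) li iD /= negbK => ->.
exists s' => //; rewrite -DesE; apply/setP => k; rewrite in_setD1.
have [l lk|no_l] := pickP (fun l : 'I_n => l == k.+1 :> nat); last first.
  have noDes s0 : (k \in Des s0) = false.
    by apply/negP => /Des_succ[l /eqP]; rewrite no_l.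
  by rewrite !noDes andbF.
rewrite !(mem_Des _ (eqP lk)) !permM; have [ki|neq_ki] := eqVneq k i.
  have -> : l = j by apply: val_inj; rewrite /= (eqP lk) ki ji.
  by rewrite ki s'i s'j tpermL tpermR a0 b1.
apply: tperm01_ltn => //.
  by rewrite -s'i (inj_eq perm_inj) (negbTE neq_ki) andbF.
rewrite -s'i -s'j !(inj_eq perm_inj); apply/andP => -[/eqP li /eqP kj].
by move: (eqP lk); rewrite li kj ji => /eqP; rewrite -addn2 -[X in X == _]addn0 eqn_add2l.
Qed.

(** Descents that are not peaks are removed one at a time, the last one first: a descent right after
    it would again be a descent and no peak. *)
Lemma Des_eq_Peak (T : Type) (phi : 'S_n -> T) :
  (forall s1 s2, Des s1 = Des s2 -> phi s1 = phi s2) ->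
  (forall s (a b : 'I_n), a = 0%N :> nat -> b = 1%N :> nat ->
     phi (s * tperm a b)%g = phi s) ->
  forall s, exists s', [/\ Des s' = Peak s', Peak s' = Peak s & phi s' = phi s].
Proof.
move=> phiD phi_t s; have [m] := ubnP #|Des s|; elim: m s => // m IH s le_m.
have [DP|] := eqVneq (Des s :\: Peak s) set0.
  exists s; split=> //; apply/eqP; rewrite eqEsubset Peak_sub_Des andbT.
  by rewrite -setD_eq0 DP.
case/set0Pn=> i0 i0DP.
case: (@arg_maxnP _ i0 (mem (Des s :\: Peak s)) val i0DP) => i iDP max_i.
have /setDP[iD iNP] : i \in Des s :\: Peak s by []; have [j ji] := Des_succ iD.
have jND k : k = i.+1 :> nat -> k \notin Des s.
  move=> ki; apply/negP => kD; have /max_i : k \in Des s :\: Peak s.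
    by rewrite inE kD (mem_Peak s ki) iD andbF.
  by rewrite /= ki ltnn.
have n_gt1 : (1 < n)%N by apply: leq_ltn_trans (ltn_ord j); rewrite ji.
have [s1 Des_s1 Des_s2] :=
  @remove_descent s i (Ordinal (ltnW n_gt1)) (Ordinal n_gt1) erefl erefl iD iNP jND.
have phi_s1 := phi_t s1 (Ordinal (ltnW n_gt1)) (Ordinal n_gt1) erefl erefl.
rewrite (phiD _ _ Des_s1) in phi_s1; move: (s1 * _)%g phi_s1 Des_s2 => s2 phi_s2 Des_s2.
(* Only [i] and its successor could change status; [i] was no peak, and its successor is no
   descent. *)
have Peak_s2 : Peak s2 = Peak s.
  apply/setP => k; have [h kh|no_h] := pickP (fun h : 'I_n => k == h.+1 :> nat); last first.
    by apply/idP/idP => /Peak_pred[h /eqP]; rewrite no_h.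
  rewrite !(mem_Peak _ (eqP kh)) Des_s2 !in_setD1.
  have [ki|neq_ki] := eqVneq k i.
    by move: iNP; rewrite -ki (mem_Peak s (eqP kh)) => /negbTE ->.
  have [hi|//] := eqVneq h i; rewrite (negbTE (jND k _)) //.
  by rewrite (eqP kh) hi.
have [|s' [DP PP ps]] := IH s2.
  by rewrite Des_s2; rewrite (cardsD1 i) iD in le_m.
by exists s'; rewrite -Peak_s2 -phi_s2.
Qed.

End Toggle.

(** * Brackets of two letters in words with distinct letters *)

Section Words.

Variables (K : fieldType) (X : choiceType).

Lemma uniq_words (infX : forall s : seq X, exists x : X, x \notin s) m :
  exists2 x : seq X, size x = m & uniq x.
Proof.
elim: m => [|m [x sz_x ux]]; first by exists [::].
by have [y yx] := infX x; exists (y :: x); rewrite /= ?sz_x ?yx.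
Qed.

Lemma malgUM (u v : {fmonom X}) :
  << u >> * << v >> = << mmul u v >> :> freeAlg K X.
Proof. by rewrite malgM_def fgmulUU mulr1. Qed.

Lemma prod_letters (y : seq X) :
  \prod_(z <- y) << fmu z >> = << FMonom y >> :> freeAlg K X.
Proof.
elim: y => [|z y IH]; rewrite ?big_nil ?big_cons; last rewrite IH malgUM.
- by congr << _ >>; apply: val_inj; rewrite /= fm1.
- by congr << _ >>; apply: val_inj; rewrite /= fmM fmU.
Qed.

Lemma homogeneous_letter (x : X) : homogeneous 1 (<< fmu x >> : freeAlg K X).
Proof. by move=> w; rewrite msuppU1 inE => /eqP ->; rewrite fdegU. Qed.

Lemma homogeneousB m (f g : freeAlg K X) :
  homogeneous m f -> homogeneous m g -> homogeneous m (f - g).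
Proof.
by move=> hf hg w /(fsubsetP (msuppB_le _ _)); rewrite inE => /orP[/hf|/hg].
Qed.

Lemma mcoeff_polya_wordB n (phi : permspace K n) (v w u : {fmonom X}) :
  (polya phi (<< v >> - << w >>))@_u =
  \sum_s phi s * ((polya_word s v == u)%:R - (polya_word s w == u)%:R).
Proof.
rewrite mcoeff_polya; apply: eq_bigr => s _; congr (_ * _).
pose c (w : {fmonom X}) : K := (polya_word s w == u)%:R.
by rewrite -[LHS]/(mmap idfun c _) mmapB !mmapU /= !mul1r.
Qed.

(** Distinct letters make all place permutations of the word distinct, so its image under [s] has
    coefficient [phi s] minus [phi (s * t)]. *)
Lemma polya_bracket_word m (phi : permspace K m.+2) a b (y : seq X) :
  size y = m -> uniq [:: a, b & y] ->
  polya phi (<< FMonom [:: a, b & y] >> - << FMonom [:: b, a & y] >>) = 0 ->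
  forall s (i0 i1 : 'I_m.+2), i0 = 0%N :> nat -> i1 = 1%N :> nat ->
  phi (s * tperm i0 i1)%g = phi s.
Proof.
move=> sz_y ux phi0 s i0 i1 i00 i11; set t := tperm i0 i1.
have [x def_x] : exists x : m.+2.-tuple X, x = [:: a, b & y] :> seq X.
  by exists (@Tuple _ _ [:: a, b & y] (introT eqP (congr1 (addn 2) sz_y))).
have x_t : FMonom [:: b, a & y] = polya_word t (FMonom x).
  rewrite polya_word_tuple; congr FMonom; apply: (@eq_from_nth _ a).
    by rewrite size_map size_enum_ord /= sz_y.
  move=> k; rewrite [size _]/= sz_y => lt_k.
  transitivity (tnth [tuple tnth x (t i) | i < m.+2] (Ordinal lt_k)); last first.
    by rewrite (tnth_nth a).
  rewrite tnth_mktuple (tnth_nth a) def_x.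
  have [e|ne0] := eqVneq (Ordinal lt_k) i0.
    by rewrite e tpermL i11 (_ : k = 0%N) // -i00 -e.
  have [e|ne1] := eqVneq (Ordinal lt_k) i1.
    by rewrite e tpermR i00 (_ : k = 1%N) // -i11 -e.
  rewrite tpermD 1?eq_sym //; case: k lt_k ne0 ne1 => [|[|k]] lt_k ne0 ne1 //.
    by case/eqP: ne0; apply: val_inj.
  by case/eqP: ne1; apply: val_inj.
have ux' : uniq x by rewrite def_x.
have inj_x (s1 s2 : 'S_m.+2) :
    (polya_word s1 (FMonom x) == polya_word s2 (FMonom x)) = (s1 == s2).
  apply/eqP/eqP => [|-> //]; rewrite !polya_word_tuple => eq_w.
  have eq_x : [tuple tnth x (s1 i) | i < m.+2] = [tuple tnth x (s2 i) | i < m.+2].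
    by apply: val_inj; case: eq_w.
  apply/permP => k; apply: (tuple_uniqP _ ux').
  by have := congr1 (fun z => tnth z k) eq_x; rewrite !tnth_mktuple.
have polyaM (s1 : 'S_m.+2) :
    polya_word s1 (polya_word t (FMonom x)) = polya_word (s1 * t)%g (FMonom x).
  rewrite !polya_word_tuple; congr FMonom; apply: (congr1 val); apply: eq_from_tnth => k.
  by rewrite !tnth_mktuple permM.
have := congr1 (mcoeff (polya_word s (FMonom x))) phi0.
rewrite mcoeff0 x_t -def_x mcoeff_polya_wordB.
under eq_bigr do rewrite polyaM !inj_x mulrBr.
rewrite sumrB (bigD1 s) //= eqxx mulr1 big1 => [|s1 /negbTE->]; last by rewrite mulr0.
rewrite (bigD1 (s * t)%g) //= -mulgA tperm2 mulg1 eqxx mulr1 big1 => [|s1 ne]; last first.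
  rewrite (_ : (s1 * t == s)%g = false) ?mulr0 //; apply/negbTE.
  by apply: contra ne => /eqP <-; rewrite -mulgA tperm2 mulg1.
by rewrite !addr0 => /eqP; rewrite subr_eq0 => /eqP.
Qed.

Lemma malgUM3 (a b : X) (y : seq X) :
  << fmu a >> * << fmu b >> * << FMonom y >> = << FMonom [:: a, b & y] >>
  :> freeAlg K X.
Proof.
by rewrite malgUM malgUM; congr << _ >>; apply: val_inj; rewrite /= !fmM !fmU.
Qed.

Lemma bracket_word (a b : X) (y : seq X) :
  (<< fmu a >> * << fmu b >> - << fmu b >> * << fmu a >>) * << FMonom y >> =
  << FMonom [:: a, b & y] >> - << FMonom [:: b, a & y] >> :> freeAlg K X.
Proof.
rewrite -(malgUM3 a b) -(malgUM3 b a).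
exact: mulrBl.
Qed.

End Words.

(** * Characterization of the peak space inside the descent space *)

Theorem theorem8 (K : fieldType) (charK0 : [pchar K] =i pred0)
    (X : choiceType) (infX : forall s : seq X, exists x : X, x \notin s)
    (n : nat) (phi : permspace K n) (phiD : phi \in descent_space K n) :
  phi \in peak_space K n <->
  (forall (q1 : nat) (q : seq nat),
     composition n (q1 :: q) -> ~~ odd q1 ->
     forall P : 'I_(size (q1 :: q)) -> freeAlg K X,
       (forall i : 'I_(size (q1 :: q)), lie_homog (nth 0%N (q1 :: q) i) (P i)) ->
       polya phi (\prod_(i < size (q1 :: q)) P i) = 0).
Proof.
split=> [phiP q1 q /andP[_ /eqP sum_q] q1_even P lieP|H].
  move: phi phiP {phiD}; apply: span_ind => [|a u v Hu Hv|_ /mapP[Q _ ->]].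
  - exact: polya0.
  - by rewrite polyaD polyaZ Hu Hv scaler0 addr0.
  apply: polya_peak_sum => E.
  have hprod : homogeneous n (\prod_(i < size (q1 :: q)) P i).
    rewrite -sum_q sumnE (big_nth 0%N) big_mkord.
    by apply: homogeneous_prod => i; have [] := lieP i.
  rewrite big_ord_recl in hprod *; have [lieP0 homP0] := lieP ord0.
  apply: polya_near_sum_lie lieP0 homP0 q1_even hprod.
  by have/pcharf0P -> := charK0.
have phi_Des s1 s2 : Des s1 = Des s2 -> phi s1 = phi s2.
  exact: descent_space_Des.
apply: mem_peak_space => s1 s2 eqP12.
have phi_t s (a b : 'I_n) : a = 0%N :> nat -> b = 1%N :> nat ->
    phi (s * tperm a b)%g = phi s.
  case: n phi {phiD phi_Des s1 s2 eqP12} H s a b => [|[|m]] phi H s a b a0 b1.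
  - by case: a a0.
  - by have := ltn_ord b; rewrite b1.
  have [[|x [|y z]] //= [sz_z] uz] := uniq_words infX m.+2.
  apply: (polya_bracket_word sz_z uz) a0 b1.
  pose f (k : nat) : freeAlg K X := << fmu (nth x [:: x, y & z] k) >>.
  (* The composition is [2.1. ... .1]; its first factor, the bracket, uses two letters, hence the
     shift to [f i.+1] for the others. *)
  pose P (i : 'I_(size (2%N :: nseq m 1%N))) : freeAlg K X :=
    if i : nat is 0 then f 0%N * f 1%N - f 1%N * f 0%N else f i.+1.
  have homf k : homogeneous 1 (f k) by apply: homogeneous_letter.
  have lief k : lie (f k) by apply: lie_gen.
  have <- : \prod_(i < size (2%N :: nseq m 1%N)) P i =
      << FMonom [:: x, y & z] >> - << FMonom [:: y, x & z] >>.
    have -> : \prod_(i < size (2%N :: nseq m 1%N)) P i =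
        (f 0%N * f 1%N - f 1%N * f 0%N) * \prod_(i < size (nseq m 1%N)) f i.+2.
      by rewrite big_ord_recl.
    rewrite size_nseq -sz_z -(big_mkord xpredT (fun i => f i.+2)).
    rewrite -(big_nth x xpredT (fun u => << fmu u >> : freeAlg K X)) prod_letters.
    exact: bracket_word.
  apply: H => // [|[[|k] lt_k]].
  - by rewrite /composition /= all_nseq orbT sumn_nseq mul1n add2n eqxx.
  - split; first exact: lie_bracket.
    by apply: homogeneousB; apply: (@homogeneousM _ _ 1 1).
  - have lt_km : (k < m)%N by move: (lt_k); rewrite /= size_nseq ltnS.
    by rewrite /= nth_nseq lt_km; split; [apply: lief | apply: homf].
(* Both permutations are replaced by ones whose descent set is the common peak set, where [phi]
   agrees. *)
have [t1 [DP1 PP1 <-]] := Des_eq_Peak phi_Des phi_t s1.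
have [t2 [DP2 PP2 <-]] := Des_eq_Peak phi_Des phi_t s2.
by apply: phi_Des; rewrite DP1 DP2 PP1 PP2.
Qed.
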